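(* Let $c>0$ be a constant, let $m$ be a fixed positive integer, and let $g_1,\dots,g_m\ge 0$ be fixed with $\sum_{r=1}^m g_r=1$. For each $n$ (with $c/n<1$ and each $g_r n$ an integer), consider $G(n,n,c/n)$ in which exactly $n_r=g_r n$ bins have rank $r$, and let $\mu^r_{\mathrm{W}}(n,n,c/n)$ denote the number of rank-$r$ bins matched by \textsc{vertex-weighted greedy}. Writing $S_r=\sum_{k=1}^r g_k$ (so $S_0=0$), for each $1\le r\le m$, asymptotically almost surely $$\frac{\mu^r_{\mathrm{W}}(n,n,c/n)}{n} = g_r - \frac{1}{c}\log\left(\frac{1+e^{-c}\left(e^{cS_r}-1\right)}{1+e^{-c}\left(e^{cS_{r-1}}-1\right)}\right)+o(1).$$
   Context: For a positive integer $n$ and $p\in(0,1)$, $G(n,n,p)$ is the random bipartite graph with a set $I$ of $n$ ''bins'' and a set $J$ of $n$ ''balls'', each pair $(i,j)\in I\times J$ being an edge independently with probability $p$. Each bin $i$ has a rank $r_i\in\{1,\dots,m\}$ fixed before any arrivals (lower rank is preferable). Online model: balls arrive one at a time; when ball $j$ arrives its neighboring bins are revealed and the algorithm must immediately and irrevocably match $j$ to an unmatched bin or drop it; each bin is matched at most once. The \textsc{vertex-weighted greedy} algorithm: when ball $j$ arrives, let $U(j)$ be the set of its currently unmatched neighboring bins; if $U(j)\ne\emptyset$, match $j$ to a bin of smallest rank in $U(j)$ (ties broken arbitrarily), otherwise drop $j$. ''Asymptotically almost surely'' means with probability $1-o(1)$ as $n\to\infty$; $\log$ is the natural logarithm. 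*)

(* Defs.v *)
From mathcomp Require Import all_boot all_order all_fingroup all_algebra.
From mathcomp Require Import all_classical all_reals all_analysis.

Set Implicit Arguments.
Unset Strict Implicit.
Unset Printing Implicit Defensive.

Import Order.TTheory GRing.Theory Num.Theory.
Import numFieldNormedType.Exports.
Local Open Scope ring_scope.

(* A bipartite graph is its set of edges (i, j), with i a bin and j a ball. *)
Definition bigraph (n : nat) := {set 'I_n * 'I_n}.

Definition nbhd n (E : bigraph n) (j : 'I_n) : {set 'I_n} :=
  [set i | (i, j) \in E].

Definition Gnnp_weight (R : realType) n (p : R) (E : bigraph n) : R :=
  \prod_(e : 'I_n * 'I_n) (if e \in E then p else 1 - p).

Definition Gnnp_prob (R : realType) n (p : R) (A : pred (bigraph n)) : R :=
  \sum_(E : bigraph n | A E) Gnnp_weight p E.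

Section VertexWeightedGreedy.
Variables (n m : nat) (rank : 'I_n -> 'I_m).

Definition smallest_rank (U : {set 'I_n}) : {set 'I_n} :=
  [set i in U | [forall k in U, (rank i <= rank k)%N]].

(* A tie-breaking rule selects a bin in the set C of tied bins. It is online:
   besides C, it sees only the neighborhoods h revealed so far, in order of
   arrival, the last one being that of the current ball. *)
Definition tie_breaker := seq {set 'I_n} -> {set 'I_n} -> option 'I_n.

Definition valid_tie_breaker (tie : tie_breaker) : Prop :=
  forall h C, if tie h C is Some i then i \in C else C == finset.set0.

(* Bins matched at the end of a run on the arrivals Ns (the neighborhoods of the
   arriving balls), starting after the arrivals h with set M of matched bins. *)
Fixpoint greedy_run (tie : tie_breaker) (h : seq {set 'I_n}) (M : {set 'I_n})
    (Ns : seq {set 'I_n}) : {set 'I_n} :=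
  if Ns is N :: Ns' then
    let h' := rcons h N in
    let U := N :\: M in
    let M' := if tie h' (smallest_rank U) is Some i then i |: M else M in
    greedy_run tie h' M' Ns'
  else M.

(* The k-th ball to arrive is order k. *)
Definition greedy_matched (order : 'S_n) (tie : tie_breaker) (E : bigraph n) :
    {set 'I_n} :=
  greedy_run tie [::] finset.set0 [seq nbhd E (order k) | k <- enum 'I_n].

Definition mu_W (order : 'S_n) (tie : tie_breaker) (r : 'I_m) (E : bigraph n) :
    nat :=
  #|[set i in greedy_matched order tie E | rank i == r]|.

End VertexWeightedGreedy.

(* Ranks 1, ..., m are encoded as 0, ..., m - 1, so that r : 'I_m stands for the
   rank r + 1; gsum g k is still g_1 + ... + g_k. *)
Definition gsum (R : realType) m (g : 'I_m -> R) (k : nat) : R :=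
  \sum_(i < m | (i < k)%N) g i.

Definition mu_limit (R : realType) (c : R) m (g : 'I_m -> R) (r : 'I_m) : R :=
  g r - c^-1 * ln ((1 + expR (- c) * (expR (c * gsum g r.+1) - 1)) /
                   (1 + expR (- c) * (expR (c * gsum g r) - 1))).

Definition admissible (R : realType) (c : R) m (g : 'I_m -> R) : set nat :=
  [set n | [/\ (0 < n)%N, c / n%:R < 1 &
               forall r, g r * n%:R \is a Num.int]]%classic.

(* Main.v *)
(* For each level l, the number Y of free bins of rank below l evolves as a
   Markov chain on its own: an arriving ball lowers Y by one exactly when it has
   a free neighbour of rank below l, which has probability 1 - q^Y with
   q = 1 - c / n. The quantity Z = q^-Y - 1 satisfies E[Z' | Z] = q Z exactly and
   has increments of order 1 / n, so Z at time n is within o(1) of q^n Z_0 in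
   L^2. Taking logarithms gives the fraction of free bins below each level, and
   the rank-r count is the difference between two consecutive levels. *)
Require Import Defs.
From mathcomp Require Import all_boot all_order all_fingroup all_algebra.
From mathcomp Require Import all_classical all_reals all_analysis.
From mathcomp Require Import ring lra.

Set Implicit Arguments.
Unset Strict Implicit.
Unset Printing Implicit Defensive.

Import Order.TTheory GRing.Theory Num.Theory.
Import numFieldNormedType.Exports.
Local Open Scope ring_scope.

(** * Weighted sums over sequences of independent draws *)

Section TupleMean.
Variables (R : comNzRingType) (T : finType) (w : T -> R).

(** The argument [f] takes a sequence, not a tuple, so that it can be a run of the algorithm and the
    first draw can be peeled off without casts. *)
Definition tuple_mean (k : nat) (f : seq T -> R) : R :=
  \sum_(t : k.-tuple T) (\prod_(x <- t) w x) * f t.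

Lemma tuple_mean0 (f : seq T -> R) : tuple_mean 0 f = f [::].
Proof.
rewrite /tuple_mean (bigD1 [tuple]) //= big_nil mul1r big1 ?addr0 //.
by move=> t /eqP[]; rewrite [LHS]tuple0 [RHS]tuple0.
Qed.

Lemma tuple_meanS (k : nat) (f : seq T -> R) :
  tuple_mean k.+1 f = \sum_x w x * tuple_mean k (fun s => f (x :: s)).
Proof.
rewrite /tuple_mean.
rewrite (reindex (fun p : T * k.-tuple T => [tuple of p.1 :: p.2])) /=; last first.
  exists (fun t => (thead t, [tuple of behead t])) => [[x t] _|t _] /=.
    by congr (_, _); apply: val_inj.
  by rewrite [RHS]tuple_eta.
rewrite -(pair_bigA _ (fun x (t : k.-tuple T) =>
  (\prod_(y <- x :: t) w y) * f (x :: t))) /=.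
apply: eq_bigr => x _; rewrite mulr_sumr; apply: eq_bigr => t _.
by rewrite big_cons mulrA.
Qed.

End TupleMean.

(** * Random subsets with independent memberships *)

Section RandomSet.
Variables (R : comNzRingType) (I : finType) (p : R).

Definition set_weight (N : {set I}) : R :=
  \prod_(i : I) (if i \in N then p else 1 - p).

Lemma set_weight_sum1 : \sum_(N : {set I}) set_weight N = 1.
Proof.
rewrite -(bigA_distr _ _ (fun=> p) (fun=> 1 - p)) /=.
by rewrite big1 // => i _; rewrite addrC subrK.
Qed.

(** Giving weight 0 to the membership of elements of [A] kills exactly the sets that meet [A]. The
    sum over all sets then factors elementwise: [1 - p] on [A] and [1] elsewhere. *)
Lemma set_weight_disjoint (A : {set I}) :
  \sum_(N : {set I} | [disjoint N & A]) set_weight N = (1 - p) ^+ #|A|.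
Proof.
transitivity (\sum_(N : {set I})
    \prod_(i : I) (if i \in N then (if i \in A then 0 else p) else 1 - p)).
  rewrite big_mkcond /=; apply: eq_bigr => N _.
  case: ifPn => [dNA | ].
    by apply: eq_bigr => i _; case: ifP => // iN; rewrite (disjointFr dNA).
  rewrite -setI_eq0 => /set0Pn [i]; rewrite inE => /andP [iN iA].
  by rewrite (bigD1 i) //= iN iA mul0r.
rewrite -(bigA_distr _ _ (fun i => if i \in A then 0 else p) (fun=> 1 - p)) /=.
rewrite (bigID (mem A)) /= [X in _ * X]big1 ?mulr1.
  by rewrite (eq_bigr (fun=> 1 - p)) ?prodr_const // => i ->; rewrite add0r.
by move=> i /negbTE ->; rewrite addrC subrK.
Qed.

End RandomSet.

Lemma set_weight_ge0 (R : realType) (I : finType) (p : R) (N : {set I}) :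
  0 <= p <= 1 -> 0 <= set_weight p N.
Proof.
by move=> /andP[p0 p1]; apply: prodr_ge0 => i _; case: ifP; rewrite ?subr_ge0.
Qed.

Lemma Gnnp_weight_ge0 (R : realType) (n : nat) (p : R) (E : bigraph n) :
  0 <= p <= 1 -> 0 <= Gnnp_weight p E.
Proof. exact: set_weight_ge0. Qed.

Lemma Gnnp_weight_sum1 (R : realType) (n : nat) (p : R) :
  \sum_(E : bigraph n) Gnnp_weight p E = 1.
Proof. exact: set_weight_sum1. Qed.

(** * From the random graph to independent neighborhoods *)

Section Arrivals.
Variables (R : realType) (n : nat) (p : R) (order : 'S_n).

Definition arrivals (E : bigraph n) : seq {set 'I_n} :=
  [seq nbhd E (order k) | k <- enum 'I_n].

(** A graph is the same as its list of neighborhoods in arrival order, and its weight factors over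
    balls. The arrival order thus drops out, leaving [n] independent random sets. *)
Lemma Gnnp_mean_arrivals (f : seq {set 'I_n} -> R) :
  \sum_(E : bigraph n) Gnnp_weight p E * f (arrivals E) =
  tuple_mean (set_weight p) n f.
Proof.
pose graph (t : n.-tuple {set 'I_n}) : bigraph n :=
  [set e : 'I_n * 'I_n | e.1 \in tnth t ((order^-1)%g e.2)].
have graphK t k : nbhd (graph t) (order k) = tnth t k.
  by apply/setP => i; rewrite !inE /= permK.
rewrite (reindex graph) /=; last first.
  exists (fun E => [tuple nbhd E (order k) | k < n]) => [t _|E _].
    by apply: eq_from_tnth => k; rewrite tnth_mktuple graphK.
  by apply/setP => -[i j]; rewrite !inE /= tnth_mktuple inE permKV.
apply: eq_bigr => t _; congr (_ * f _).
  rewrite big_tuple /Gnnp_weight.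
  transitivity (\prod_i \prod_j (if (i, j) \in graph t then p else 1 - p)).
    by rewrite pair_bigA /=; apply: eq_bigr => -[i j].
  rewrite exchange_big /= (reindex_perm order) /=; apply: eq_bigr => k _.
  by apply: eq_bigr => i _; rewrite -graphK !inE.
rewrite /arrivals (eq_map (graphK t)).
by rewrite -[RHS]map_tnth_enum.
Qed.

End Arrivals.

(** * Effect of one arrival on the free bins below a level *)

Section GreedyStep.
Variables (n m : nat) (rank : 'I_n -> 'I_m) (tie : tie_breaker n).
Hypothesis tie_valid : valid_tie_breaker tie.

Definition low_bins (l : nat) : {set 'I_n} := [set i | (rank i < l)%N].

Definition greedy_step (h : seq {set 'I_n}) (M N : {set 'I_n}) : {set 'I_n} :=
  if tie (rcons h N) (smallest_rank rank (N :\: M)) is Some i then i |: M else M.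

(** This forces a valid tie-breaking rule to choose a bin whenever the ball has a free neighbor. *)
Lemma smallest_rank_neq0 (U : {set 'I_n}) (k : 'I_n) :
  k \in U -> smallest_rank rank U != finset.set0.
Proof.
move=> kU; case: (arg_minnP (fun i => rank i : nat) kU) => i iU imin.
apply/set0Pn; exists i; rewrite inE; apply/andP; split=> //.
by apply/forallP => j; apply/implyP => jU; apply: imin.
Qed.

Lemma greedy_step_disjoint (l : nat) (h : seq {set 'I_n}) (M N : {set 'I_n}) :
  [disjoint N & low_bins l :\: M] ->
  low_bins l :\: greedy_step h M N = low_bins l :\: M.
Proof.
move=> dN; rewrite /greedy_step.
have := tie_valid (rcons h N) (smallest_rank rank (N :\: M)).
case: (tie _ _) => // i; rewrite !inE => /andP[/andP[iM iN] _].
apply/setP => j; rewrite !inE negb_or; case: (eqVneq j i) => [->|//].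
by have := disjointFr dN iN; rewrite !inE iM /= => ->.
Qed.

(* A ball seeing a free bin of rank below [l] is matched below [l], whatever
   the tie-breaking rule, since the rule only chooses among minimal ranks. *)
Lemma greedy_step_meet (l : nat) (h : seq {set 'I_n}) (M N : {set 'I_n}) :
  ~~ [disjoint N & low_bins l :\: M] ->
  #|low_bins l :\: M| = #|low_bins l :\: greedy_step h M N|.+1.
Proof.
rewrite -setI_eq0 => /set0Pn [k]; rewrite !inE => /andP[kN /andP[kM kl]].
have kU : k \in N :\: M by rewrite inE kM.
rewrite /greedy_step.
have := tie_valid (rcons h N) (smallest_rank rank (N :\: M)).
case: (tie _ _) => [i|]; last by rewrite (negbTE (smallest_rank_neq0 kU)).
rewrite !inE => /andP[/andP[iM iN] /forallP /(_ k)]; rewrite kU /= => ik.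
have iA : i \in low_bins l :\: M by rewrite !inE iM (leq_ltn_trans ik kl).
by rewrite (cardsD1 i) iA finset.setUC finset.setDDl.
Qed.

End GreedyStep.

(** * Second moment of the potential *)

Section SecondMoment.
Variables (R : realType) (n m : nat) (rank : 'I_n -> 'I_m) (tie : tie_breaker n).
Hypothesis tie_valid : valid_tie_breaker tie.
Variables (p : R) (l : nat).
Hypothesis p01 : 0 < p < 1.

Let q : R := 1 - p.

(* The process [q^-Y - 1], with [Y] the number of free bins of rank below [l],
   is multiplied by exactly [q] on average at each arrival. *)
Definition potential (M : {set 'I_n}) : R := q ^- #|low_bins rank l :\: M|.

Let q_gt0 : 0 < q. Proof. by move: p01 => /andP[? ?]; rewrite /q subr_gt0. Qed.
Let q_le1 : q <= 1. Proof. by move: p01 => /andP[? ?]; rewrite /q; lra. Qed.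

Lemma potential_ge1 (M : {set 'I_n}) : 1 <= potential M.
Proof.
rewrite /potential invf_ge1 ?exprn_gt0 //.
by apply: exprn_ile1 => //; apply: ltW.
Qed.

(** A crude bound suffices: for [p = c / n], [q ^- n] stays bounded as [n] grows. *)
Lemma potential_le (M : {set 'I_n}) : potential M <= q ^- n.
Proof.
rewrite /potential lef_pV2 ?posrE ?exprn_gt0 //.
apply: ler_wiXn2l => //; first exact: ltW.
by rewrite -[leqRHS]card_ord max_card.
Qed.

(** Let [W = potential M]. The ball misses the free bins below [l] with probability [1 / W] and
    leaves [W] unchanged; otherwise [W] becomes [q * W]. Hence the new potential minus 1 has mean
    [q * (W - 1)] and variance [(W - 1) * p ^+ 2], and the identity is squared bias plus
    variance. *)
Lemma potential_step (h : seq {set 'I_n}) (M : {set 'I_n}) (a : R) :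
  \sum_N set_weight p N *
     (potential (greedy_step rank tie h M N) - 1 - q * a) ^+ 2 =
  q ^+ 2 * (potential M - 1 - a) ^+ 2 + (potential M - 1) * p ^+ 2.
Proof.
set A := low_bins rank l :\: M.
rewrite (bigID (fun N : {set 'I_n} => [disjoint N & A])) /=.
rewrite (eq_bigr (fun N => set_weight p N * (potential M - 1 - q * a) ^+ 2)); last first.
  by move=> N dN; rewrite /potential greedy_step_disjoint.
rewrite [X in _ + X](eq_bigr (fun N =>
    set_weight p N * (q * potential M - 1 - q * a) ^+ 2)); last first.
  move=> N dN; congr (_ * (_ - 1 - _) ^+ 2).
  rewrite /potential (greedy_step_meet tie_valid h dN) exprS invfM.
  by rewrite mulrA divff ?mul1r // gt_eqF.
rewrite -!mulr_suml set_weight_disjoint.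
have -> : \sum_(N : {set 'I_n} | ~~ [disjoint N & A]) set_weight p N =
    1 - q ^+ #|A|.
  rewrite -(set_weight_sum1 'I_n p) [in RHS](bigID (fun N : {set 'I_n} => [disjoint N & A])) /=.
  by rewrite set_weight_disjoint addrC addrK.
have -> : q ^+ #|A| = (potential M)^-1 by rewrite invrK.
have : potential M != 0 by rewrite gt_eqF // (lt_le_trans ltr01) // potential_ge1.
by rewrite -/q (_ : p = 1 - q) 1?/q; [move: (potential M) => W W0; field | ring].
Qed.

(** The induction peels off the first arrival, which changes the history, the matched set and the
    center, [a] becoming [q * a]; hence the generality in all three. Each arrival adds at most
    [q ^- n * p ^+ 2]. *)
Lemma potential_second_moment (k : nat) (h : seq {set 'I_n}) (M : {set 'I_n}) (a : R) :
  tuple_mean (set_weight p) k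
    (fun s => (potential (greedy_run rank tie h M s) - 1 - q ^+ k * a) ^+ 2) <=
  (potential M - 1 - a) ^+ 2 + k%:R * (q ^- n * p ^+ 2).
Proof.
elim: k h M a => [|k IH] h M a.
  by rewrite tuple_mean0 mul0r addr0 expr0 mul1r.
rewrite tuple_meanS.
pose D := q ^- n * p ^+ 2.
apply: (@le_trans _ _ (\sum_N set_weight p N *
   ((potential (greedy_step rank tie h M N) - 1 - q * a) ^+ 2 + k%:R * D))).
  apply: ler_sum => N _; apply: ler_wpM2l.
    by apply: set_weight_ge0; move: p01 => /andP[/ltW -> /ltW ->].
  by have := IH (rcons h N) (greedy_step rank tie h M N) (q * a); rewrite mulrA -exprSr.
under eq_bigr do rewrite mulrDr.
rewrite big_split /= -mulr_suml set_weight_sum1 mul1r potential_step.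
rewrite -natr1 [X in _ <= _ + X]mulrDl mul1r [X in _ <= _ + X]addrC addrA lerD2r.
apply: lerD.
  (* The contraction factor [q ^+ 2] is simply bounded by 1. *)
  by rewrite ler_piMl ?sqr_ge0 // expr_le1 // ltW.
rewrite ler_wpM2r ?sqr_ge0 // (le_trans _ (potential_le M)) //.
by rewrite lerBlDr lerDl.
Qed.

End SecondMoment.

(** * Markov and union bounds for the random graph *)

Section GnnpProb.
Variables (R : realType) (n : nat) (p : R).
Hypothesis p01 : 0 <= p <= 1.

Lemma Gnnp_markov (X : bigraph n -> R) (t : R) :
  0 < t -> (forall E, 0 <= X E) ->
  Gnnp_prob p (fun E => t <= X E) <= (\sum_E Gnnp_weight p E * X E) / t.
Proof.
move=> t0 X0; rewrite ler_pdivlMr // /Gnnp_prob mulr_suml big_mkcond /=.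
apply: ler_sum => E _; have w0 := Gnnp_weight_ge0 E p01.
by case: ifP => [tX|_]; [apply: ler_wpM2l | apply: mulr_ge0].
Qed.

Lemma Gnnp_prob_le1 (A : pred (bigraph n)) : Gnnp_prob p A <= 1.
Proof.
rewrite -(Gnnp_weight_sum1 n p) [leRHS](bigID A) /= lerDl.
by apply: sumr_ge0 => E _; apply: Gnnp_weight_ge0.
Qed.

Lemma Gnnp_prob_union_bound (A B C : pred (bigraph n)) :
  (forall E, ~~ B E -> ~~ C E -> A E) ->
  1 - (Gnnp_prob p B + Gnnp_prob p C) <= Gnnp_prob p A.
Proof.
move=> ABC; rewrite lerBlDr -(Gnnp_weight_sum1 n p) /Gnnp_prob.
rewrite [in leRHS]big_mkcond [X in _ <= _ + (X + _)]big_mkcond.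
rewrite [X in _ <= _ + (_ + X)]big_mkcond -!big_split /=.
apply: ler_sum => E _; have w0 := Gnnp_weight_ge0 E p01.
by have := ABC E; case: (A E); case: (B E); case: (C E) => //= H; try lra;
  have := H isT isT.
Qed.

End GnnpProb.

(** * Matched bins of one rank from free bins at two levels *)

Lemma card_low_bins_recr (n m : nat) (rank : 'I_n -> 'I_m) (M : {set 'I_n})
    (r : 'I_m) :
  (#|[set i in M | rank i == r]| + #|low_bins rank r.+1 :\: M| =
   #|[set i | rank i == r]| + #|low_bins rank r :\: M|)%N.
Proof.
set B := [set i | rank i == r].
(* The free bins of rank at most [r] split into those of rank [r] and those of smaller rank. *)
have -> : low_bins rank r.+1 :\: M = (B :\: M) :|: (low_bins rank r :\: M).
  apply/setP => i; rewrite !inE ltnS leq_eqVlt -andb_orr.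
  by congr (_ && (_ || _)); rewrite -val_eqE.
rewrite cardsU (_ : _ :&: _ = finset.set0) ?cards0 ?subn0; last first.
  apply/setP => i; rewrite !inE; apply/negP.
  by move=> /andP[/andP[_ /eqP->] /andP[_]]; rewrite ltnn.
rewrite addnA; congr (_ + _)%N; rewrite -[RHS](cardsID M); congr (_ + _)%N.
by apply: eq_card => i; rewrite !inE andbC.
Qed.

Section AdmissibleRanks.
Variables (R : realType) (n m : nat) (rank : 'I_n -> 'I_m) (g : 'I_m -> R).
Hypothesis rank_card :
  forall r : 'I_m, #|[pred i | rank i == r]|%:R = g r * n%:R.

Lemma card_low_bins (l : nat) : #|low_bins rank l|%:R = gsum g l * n%:R.
Proof.
rewrite /gsum mulr_suml.
transitivity (\sum_(r < m | (r < l)%N) #|[pred i | rank i == r]|%:R : R); last first.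
  by apply: eq_bigr => r _; rewrite rank_card.
rewrite -natr_sum; congr _%:R.
rewrite -sum1_card (partition_big rank (fun r : 'I_m => (r < l)%N)) /=; last first.
  by move=> i; rewrite inE.
apply: eq_bigr => r rl; rewrite -sum1_card; apply: eq_bigl => i.
by rewrite !inE; case: eqP => [->|]; rewrite ?rl ?andbF.
Qed.

Lemma card_matched_rank (M : {set 'I_n}) (r : 'I_m) : (0 < n)%N ->
  #|[set i in M | rank i == r]|%:R / n%:R =
  g r - (#|low_bins rank r.+1 :\: M|%:R / n%:R - #|low_bins rank r :\: M|%:R / n%:R) :> R.
Proof.
move=> n0; have nz : n%:R != 0 :> R by rewrite pnatr_eq0 -lt0n.
have := congr1 (fun k => k%:R : R) (card_low_bins_recr rank M r).
rewrite !natrD (_ : #|[set i | rank i == r]| = #|[pred i | rank i == r]|); last first.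
  by apply: eq_card => i; rewrite !inE.
rewrite rank_card => /eqP; rewrite -subr_eq => /eqP gE.
by rewrite -[g r](mulfK nz) -gE; field.
Qed.

End AdmissibleRanks.

(** * The fluid limit and the effective rate *)

Lemma ln_lipschitz (R : realType) (x y : R) :
  1 <= x -> 1 <= y -> `|ln x - ln y| <= `|x - y|.
Proof.
wlog yx : x y / y <= x => [H x1 y1|x1 y1].
  by case/orP: (le_total y x) => ?; [|rewrite distrC [leRHS]distrC]; apply: H.
have y0 : 0 < y by rewrite (lt_le_trans ltr01).
have x0 : 0 < x by rewrite (lt_le_trans ltr01).
rewrite !ger0_norm ?subr_ge0 ?ler_ln ?posrE // -ln_div ?posrE //.
(* Now [ln (1 + d) <= d] applies with [d = (x - y) / y], and [d <= x - y] because [1 <= y]. *)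
have -> : x / y = 1 + (x - y) / y by rewrite mulrBl divff ?gt_eqF //; ring.
have d0 : 0 <= (x - y) / y by rewrite divr_ge0 ?subr_ge0 // ltW.
apply: (le_trans (le_ln1Dx _)); first by rewrite (lt_le_trans _ d0) // ltrN10.
by rewrite ler_pdivrMr // ler_peMr // subr_ge0.
Qed.

(* The value at time 1 of the solution of y' = exp (- lam y) - 1, y(0) = s. *)
Definition fluid_limit (R : realType) (lam s : R) : R :=
  lam^-1 * ln (1 + expR (- lam) * (expR (lam * s) - 1)).

(* Chosen so that [1 - c / n = expR (- rate c n / n)]. *)
Definition rate (R : realType) (c : R) (n : nat) : R :=
  - (n%:R * ln (1 - c / n%:R)).

(** This keeps the argument of [ln] where [ln] is 1-Lipschitz. *)
Lemma fluid_limit_arg_ge1 (R : realType) (lam s : R) : 0 <= lam -> 0 <= s ->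
  1 <= 1 + expR (- lam) * (expR (lam * s) - 1).
Proof.
move=> lam0 s0; rewrite lerDl mulr_ge0 ?expR_ge0 // subr_ge0 -expR0 ler_expR.
exact: mulr_ge0.
Qed.

Lemma gsum_ge0 (R : realType) (m : nat) (g : 'I_m -> R) (l : nat) :
  (forall r, 0 <= g r) -> 0 <= gsum g l.
Proof. by move=> g0; apply: sumr_ge0. Qed.

Lemma mu_limitE (R : realType) (c : R) (m : nat) (g : 'I_m -> R) (r : 'I_m) :
  0 <= c -> (forall r, 0 <= g r) ->
  mu_limit c g r =
  g r - (fluid_limit c (gsum g r.+1) - fluid_limit c (gsum g r)).
Proof.
move=> c0 g0; rewrite /mu_limit /fluid_limit -mulrBr ln_div //;
  by rewrite posrE (lt_le_trans ltr01) ?fluid_limit_arg_ge1 ?gsum_ge0.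
Qed.

Section Rate.
Variables (R : realType) (c : R) (n : nat).
Hypotheses (c_gt0 : 0 < c) (n_gt0 : (0 < n)%N) (cn_lt1 : c / n%:R < 1).

Let q_gt0 : 0 < 1 - c / n%:R. Proof. by rewrite subr_gt0. Qed.
Let nR_gt0 : 0 < n%:R :> R. Proof. by rewrite ltr0n. Qed.

Lemma rate_ge : c <= rate c n.
Proof.
rewrite /rate -mulrN -ler_pdivrMl // mulrC lerNr.
by apply: le_ln1Dx; rewrite ltrN2.
Qed.

Lemma rate_le : rate c n <= c / (1 - c / n%:R).
Proof.
rewrite /rate -mulrN -ler_pdivlMl // -lnV ?posrE //.
have qV : (1 - c / n%:R)^-1 = 1 + n%:R^-1 * (c / (1 - c / n%:R)).
  rewrite mulrA [n%:R^-1 * c]mulrC.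
  by move: (c / n%:R) q_gt0 => x /gt_eqF x1; field; rewrite x1.
rewrite [X in ln X]qV.
apply: le_ln1Dx; apply: (@lt_le_trans _ _ 0); first by rewrite ltrN10.
by rewrite mulr_ge0 ?invr_ge0 ?divr_ge0 // ?ltW.
Qed.

(** Powers of [1 - c / n] become exponentials exactly, so the only deterministic error is the
    replacement of the rate by [c] at the end. *)
Lemma expR_rate (k : nat) :
  (1 - c / n%:R) ^- k = expR (rate c n * (k%:R / n%:R)).
Proof.
have -> : rate c n * (k%:R / n%:R) = - (ln (1 - c / n%:R) *+ k).
  by rewrite /rate -mulr_natr; field; rewrite gt_eqF.
by rewrite expRN -lnXn // lnK // posrE exprn_gt0.
Qed.

End Rate.

(** * Concentration at fixed [n] *)

Section Concentration.
Variables (R : realType) (c : R) (n m : nat) (rank : 'I_n -> 'I_m) (g : 'I_m -> R).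
Variables (order : 'S_n) (tie : tie_breaker n).
Hypotheses (c_gt0 : 0 < c) (n_gt0 : (0 < n)%N) (cn_lt1 : c / n%:R < 1).
Hypothesis g_ge0 : forall r, 0 <= g r.
Hypothesis rank_card :
  forall r : 'I_m, #|[pred i | rank i == r]|%:R = g r * n%:R.
Hypothesis tie_valid : valid_tie_breaker tie.

Let free_fraction (l : nat) (E : bigraph n) : R :=
  #|low_bins rank l :\: greedy_matched rank order tie E|%:R / n%:R.

Let nR_gt0 : 0 < n%:R :> R. Proof. by rewrite ltr0n. Qed.
Let p01 : 0 < c / n%:R < 1. Proof. by rewrite divr_gt0. Qed.
Let rate_gt0 : 0 < rate c n.
Proof. by apply: lt_le_trans c_gt0 _; apply: rate_ge. Qed.

(** Both quantities are the inverse rate times a logarithm: of the final potential, and of its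
    predicted value [1 + q ^+ n * (W0 - 1)], where [q = 1 - c / n] and [W0] is the initial
    potential. Both arguments are at least 1, and the inverse rate is at most [c^-1]. *)
Lemma free_fraction_lipschitz (l : nat) (E : bigraph n) :
  `|free_fraction l E - fluid_limit (rate c n) (gsum g l)| <=
  c^-1 * `|potential rank (c / n%:R) l (greedy_matched rank order tie E) - 1 -
     (1 - c / n%:R) ^+ n * (potential rank (c / n%:R) l finset.set0 - 1)|.
Proof.
set M := greedy_matched _ _ _ _; set p := c / n%:R.
have fE : free_fraction l E = (rate c n)^-1 * ln (potential rank p l M).
  by rewrite /potential expR_rate // expRK mulKf // gt_eqF.
have p0E : potential rank p l finset.set0 = expR (rate c n * gsum g l).
  rewrite /potential expR_rate // finset.setD0 (card_low_bins rank_card).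
  by rewrite mulfK // gt_eqF.
have qnE : (1 - p) ^+ n = expR (- rate c n).
  rewrite expRN -[X in expR X]mulr1 -[X in _ * X](@divff _ n%:R) ?gt_eqF //.
  by rewrite -expR_rate // invrK.
rewrite fE p0E qnE /fluid_limit -mulrBr normrM.
rewrite [`|_^-1|]gtr0_norm ?invr_gt0 //.
apply: ler_pM; rewrite ?invr_ge0 ?normr_ge0 //; first exact: ltW.
  by rewrite lef_pV2 ?posrE //; apply: rate_ge.
rewrite -addrA -opprD; apply: ln_lipschitz; first exact: potential_ge1.
by apply: fluid_limit_arg_ge1; [exact: ltW | exact: gsum_ge0].
Qed.

(** Chebyshev's inequality: a deviation of [e] forces the potential off its prediction by at least
    [c * e]. The second moment is at most [expR (rate c n) * c ^+ 2 / n], so [c ^+ 2] cancels. *)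
Lemma free_fraction_deviation (l : nat) (e : R) : 0 < e ->
  Gnnp_prob (c / n%:R)
    (fun E => e <= `|free_fraction l E - fluid_limit (rate c n) (gsum g l)|) <=
  expR (rate c n) / n%:R / e ^+ 2.
Proof.
move=> e0; set p := c / n%:R.
have p01' : 0 <= p <= 1 by move/andP: p01 => [/ltW -> /ltW ->].
pose a := potential rank p l finset.set0 - 1.
pose X E := (potential rank p l (greedy_matched rank order tie E) - 1 -
               (1 - p) ^+ n * a) ^+ 2.
apply: (@le_trans _ _ (Gnnp_prob p (fun E => (c * e) ^+ 2 <= X E))).
  rewrite /Gnnp_prob [leLHS]big_mkcond [leRHS]big_mkcond /=.
  apply: ler_sum => E _; have w0 := Gnnp_weight_ge0 E p01'.
  case: ifP => [eE|]; last by case: ifP.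
  suff -> : (c * e) ^+ 2 <= X E by [].
  have ce0 : 0 <= c * e by rewrite mulr_ge0 // ltW.
  rewrite /X -[leRHS]real_normK ?num_real // lerXn2r ?nnegrE //.
  rewrite -ler_pdivlMl //; apply: le_trans eE _.
  exact: free_fraction_lipschitz.
apply: (le_trans (Gnnp_markov p01' _ _)).
- by rewrite exprn_gt0 // mulr_gt0.
- by move=> E; apply: sqr_ge0.
rewrite (Gnnp_mean_arrivals p order (fun s => (potential rank p l
    (greedy_run rank tie [::] finset.set0 s) - 1 - (1 - p) ^+ n * a) ^+ 2)).
have := potential_second_moment rank tie_valid l p01 n [::] finset.set0 a.
(* The center starts at the initial potential minus 1, so the initial bias vanishes. *)
rewrite /a subrr expr0n /= add0r expR_rate // divff ?gt_eqF // mulr1 -/a => H.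
rewrite ler_pdivrMr ?exprn_gt0 ?mulr_gt0 //; apply: le_trans H _.
rewrite le_eqVlt; apply/orP; left; apply/eqP.
by field; rewrite !gt_eqF.
Qed.

Lemma mu_W_concentration (r : 'I_m) (e : R) : 0 < e ->
  1 - (expR (rate c n) / n%:R / e ^+ 2) *+ 2 <=
  Gnnp_prob (c / n%:R) (fun E =>
    `|(mu_W rank order tie r E)%:R / n%:R - mu_limit c g r| <=
     `|fluid_limit (rate c n) (gsum g r.+1) - fluid_limit c (gsum g r.+1)| +
     `|fluid_limit (rate c n) (gsum g r) - fluid_limit c (gsum g r)| + e *+ 2).
Proof.
move=> e0; set p := c / n%:R.
have p01' : 0 <= p <= 1 by move/andP: p01 => [/ltW -> /ltW ->].
pose bad l E := e <= `|free_fraction l E - fluid_limit (rate c n) (gsum g l)|.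
apply: (@le_trans _ _ (1 - (Gnnp_prob p (bad r.+1) + Gnnp_prob p (bad r)))).
  by rewrite lerD2l lerN2 mulr2n; apply: lerD; apply: free_fraction_deviation.
apply: (Gnnp_prob_union_bound p01') => E; rewrite -!ltNge => b1 b2.
rewrite /mu_W (card_matched_rank rank_card) // (mu_limitE _ (ltW c_gt0)) //.
rewrite -/(free_fraction r.+1 E) -/(free_fraction r E).
move: b1 b2; set y1 := free_fraction r.+1 E; set y0 := free_fraction r E.
set f1 := fluid_limit (rate c n) (gsum g r.+1).
set f0 := fluid_limit (rate c n) (gsum g r).
set F1 := fluid_limit c (gsum g r.+1); set F0 := fluid_limit c (gsum g r) => b1 b2.
(* The error splits into two random deviations, each below [e], and two deterministic changes of
   rate. *)
have -> : g r - (y1 - y0) - (g r - (F1 - F0)) =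
  (y0 - f0) - (y1 - f1) - ((f1 - F1) - (f0 - F0)) by ring.
apply: le_trans (ler_normB _ _) _; rewrite addrC; apply: lerD.
  exact: ler_normB.
apply: le_trans (ler_normB _ _) _; rewrite mulr2n; apply: lerD; exact: ltW.
Qed.

End Concentration.

(** * Passage to the limit *)

Local Open Scope classical_set_scope.
Local Open Scope ring_scope.

Lemma cvg_invn (R : realType) : (n%:R^-1 : R) @[n --> \oo] --> (0 : R).
Proof.
rewrite -(cvg_shiftS (fun n => n%:R^-1 : R)).
exact: cvg_harmonic.
Qed.

Lemma cvg_rate (R : realType) (c : R) : 0 < c -> rate c n @[n --> \oo] --> c.
Proof.
move=> c0.
have cq : (1 - c / n%:R) @[n --> \oo] --> (1 : R).
  rewrite -[X in _ --> X]subr0; apply: cvgB; first exact: cvg_cst.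
  by rewrite -(mulr0 c); apply: cvgM; [exact: cvg_cst | exact: cvg_invn].
apply: (@squeeze_cvgr _ _ _ _ (fun=> c) (fun n => c / (1 - c / n%:R))).
- near=> n.
  have n0 : (0 < n)%N by near: n; exact: nbhs_infty_gt.
  have cn : c / n%:R < 1.
    by rewrite ltr_pdivrMr ?ltr0n // mul1r; near: n; exact: nbhs_infty_gtr.
  by rewrite rate_ge // rate_le.
- exact: cvg_cst.
- rewrite -[X in _ --> X]mulr1; apply: cvgM; first exact: cvg_cst.
  by rewrite -[X in _ --> X]invr1; apply: cvgV.
Unshelve. all: by end_near. Qed.

Lemma cvg_fluid_limit (R : realType) (c s : R) (u : nat -> R) : 0 < c -> 0 <= s ->
  u n @[n --> \oo] --> c ->
  fluid_limit (u n) s @[n --> \oo] --> fluid_limit c s.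
Proof.
move=> c0 s0 uc; apply: cvgM; first by apply: cvgV => //; rewrite gt_eqF.
apply: (@continuous_cvg _ _ _ _ _ _ (@ln R)).
  apply: continuous_ln; apply: lt_le_trans ltr01 _.
  by apply: fluid_limit_arg_ge1 => //; apply: ltW.
apply: cvgD; first exact: cvg_cst.
apply: cvgM.
  by apply: (@continuous_cvg _ _ _ _ _ _ (@expR R)); [exact: continuous_expR | exact: cvgN].
apply: cvgB; last exact: cvg_cst.
apply: (@continuous_cvg _ _ _ _ _ _ (@expR R)); first exact: continuous_expR.
by apply: cvgM => //; exact: cvg_cst.
Qed.

Theorem theorem7 (R : realType) (c : R) (hc : 0 < c)
    (m : nat) (hm : (0 < m)%N)
    (g : 'I_m -> R) (hg0 : forall r, 0 <= g r) (hg1 : \sum_(r < m) g r = 1)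
    (rank : forall n : nat, 'I_n -> 'I_m)
    (hrank : forall n : nat, admissible c g n ->
      forall r : 'I_m, #|[pred i | rank n i == r]|%:R = g r * n%:R)
    (order : forall n : nat, 'S_n)
    (tie : forall n : nat, tie_breaker n)
    (htie : forall n : nat, valid_tie_breaker (tie n))
    (r : 'I_m) :
  exists h : nat -> R,
    h n @[n --> \oo] --> (0 : R) /\
    Gnnp_prob (c / n%:R)
      (fun E : bigraph n =>
         `| (mu_W (rank n) (order n) (tie n) r E)%:R / n%:R - mu_limit c g r |
           <= h n)
      @[n --> within (admissible c g) \oo] --> (1 : R).
Proof.
have sqrt_cvg0 (u : nat -> R) : u n @[n --> \oo] --> (0 : R) ->
    Num.sqrt (u n) @[n --> \oo] --> (0 : R).
  move=> u0; rewrite -(@sqrtr0 R).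
  by apply: (@continuous_cvg _ _ _ _ _ _ (@Num.sqrt R)) => //; exact: sqrt_continuous.
(* The tolerance is [n] to the power -1/4: it vanishes, yet dividing [1 / n] by its square leaves
   [n] to the power -1/2, so the failure probability vanishes too. *)
pose e n : R := Num.sqrt (Num.sqrt n%:R^-1).
have e0 : e n @[n --> \oo] --> (0 : R).
  by apply/sqrt_cvg0/sqrt_cvg0; exact: cvg_invn.
have err0 l : `|fluid_limit (rate c n) (gsum g l) - fluid_limit c (gsum g l)|
    @[n --> \oo] --> (0 : R).
  rewrite -(@normr0 _ R) -(subrr (fluid_limit c (gsum g l))).
  apply: cvg_norm; apply: cvgB; last exact: cvg_cst.
  by apply: cvg_fluid_limit => //; [exact: gsum_ge0 | exact: cvg_rate].
exists (fun n =>
  `|fluid_limit (rate c n) (gsum g r.+1) - fluid_limit c (gsum g r.+1)| +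
  `|fluid_limit (rate c n) (gsum g r) - fluid_limit c (gsum g r)| + e n *+ 2).
split.
  rewrite -[X in _ --> X](addr0 0) -{1}(addr0 0) -[X in _ --> _ + X](mul0rn R 2).
  by apply: cvgD; [apply: cvgD; exact: err0 | exact: cvgMn].
have low1 : (1 - (expR (rate c n) * Num.sqrt n%:R^-1) *+ 2)
    @[n --> \oo] --> (1 : R).
  rewrite -[X in _ --> X]subr0; apply: cvgB; first exact: cvg_cst.
  rewrite -[X in _ --> X](mul0rn R 2); apply: cvgMn.
  rewrite -[X in _ --> X](mulr0 (expR c)); apply: cvgM.
    by apply: (@continuous_cvg _ _ _ _ _ _ (@expR R));
      [exact: continuous_expR | exact: cvg_rate].
  by apply: sqrt_cvg0; exact: cvg_invn.
(* The probability lies between the concentration bound and 1, for admissible [n] only; the bound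
   itself converges along all [n]. *)
apply: (@squeeze_cvgr _ _ _ _
  (fun n => 1 - (expR (rate c n) * Num.sqrt n%:R^-1) *+ 2) (fun=> 1)).
- rewrite near_withinE; apply: nearW => n adm; have [n0 cn _] := adm.
  have nR0 : 0 < n%:R :> R by rewrite ltr0n.
  have p01 : 0 <= c / n%:R <= 1 by rewrite divr_ge0 ?ltW.
  rewrite Gnnp_prob_le1 // andbT.
  have en0 : 0 < e n by rewrite !sqrtr_gt0 invr_gt0.
  have := mu_W_concentration (order n) hc n0 cn hg0 (hrank _ adm) (htie n) r en0.
  suff -> : expR (rate c n) / n%:R / e n ^+ 2 =
      expR (rate c n) * Num.sqrt n%:R^-1 by [].
  rewrite sqr_sqrtr ?sqrtr_ge0 // -mulrA; congr (_ * _).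
  rewrite -{1}(@sqr_sqrtr _ n%:R^-1) ?invr_ge0 ?ler0n // expr2 mulfK //.
  by rewrite gt_eqF // sqrtr_gt0 invr_gt0.
- exact: cvg_within_filter low1.
- exact: cvg_cst.
Qed.
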